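(* Let $S$ be a statement, $\mathit{pts},\mathit{pts}'\in\mathit{PTS}$, $l,l'\subseteq\mathit{Var}$, and $\gamma,\gamma',\gamma_*\in\Gamma$. Suppose that $S:(\mathit{pts},l)\to(\mathit{pts}',l')$ is derivable in the live-variables type system, that $S:\gamma\rightsquigarrow\gamma'$, that $\gamma\sim_{(\mathit{pts},l)}\gamma_*$, and that $S$ does not abort at $\gamma_*$ (i.e. $S:\gamma_*\rightsquigarrow\mathit{abort}$ does not hold). Then there exists a state $\gamma_*'\in\Gamma$ such that $S:\gamma_*\rightsquigarrow\gamma_*'$ and $\gamma'\sim_{(\mathit{pts}',l')}\gamma_*'$.
   Context: **Syntax.** $\mathit{Var}$ is a set of variables; $n$ ranges over $\mathbb{Z}$, $x,y,z$ over $\mathit{Var}$, $\oplus$ over $\{+,-,\times\}$. Arithmetic expressions: $e ::= x\mid n\mid e_1\oplus e_2$. Boolean expressions: $b ::= \mathit{true}\mid\mathit{false}\mid\neg b\mid e_1=e_2\mid e_1\le e_2\mid b_1\wedge b_2\mid b_1\vee b_2$. $FV(e)$, $FV(b)$ denote the sets of variables occurring in $e$, $b$. Statements: $S ::= x:=e\mid x:=\&y\mid *x:=e\mid x:=*y\mid \mathit{skip}\mid S_1;S_2\mid \mathit{if}\ b\ \mathit{then}\ S_t\ \mathit{else}\ S_f\mid \mathit{while}\ b\ \mathit{do}\ S_t\mid \mathit{par}\{\{S_1\},\ldots,\{S_n\}\}\mid \mathit{par\text{-}if}\{(b_1,S_1),\ldots,(b_n,S_n)\}\mid \mathit{par\text{-}for}\{S\}$,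 with $n\ge 1$. **States.** $\mathit{Addrs}=\{x'\mid x\in\mathit{Var}\}$ (a formal address $x'$ for each variable $x$, distinct for distinct variables), $\mathbb{Z}\cap\mathit{Addrs}=\emptyset$, $\mathit{Val}=\mathbb{Z}\cup\mathit{Addrs}$, $\Gamma=\mathit{Var}\to\mathit{Val}$; the states are the elements of $\Gamma\cup\{\mathit{abort}\}$. **Expression semantics** ($!$ is an error value). $[\![n]\!]\gamma=n$; $[\![x]\!]\gamma=\gamma(x)$; $[\![e_1\oplus e_2]\!]\gamma=[\![e_1]\!]\gamma\oplus[\![e_2]\!]\gamma$ if both values are in $\mathbb{Z}$, else $!$; $[\![\mathit{true}]\!]\gamma=\mathit{true}$, $[\![\mathit{false}]\!]\gamma=\mathit{false}$; $[\![e_1=e_2]\!]\gamma$ is $!$ if either side is $!$, else $\mathit{true}$ if the values are equal and $\mathit{false}$ otherwise; $[\![e_1\le e_2]\!]\gamma$ is $!$ if either value is not in $\mathbb{Z}$, else the truth value of the comparison; $\neg,\wedge,\vee$ are as usual, with result $!$ if any operand is $!$. **Operational semantics.** $S:\gamma\rightsquigarrow\mathit{state}$ (with $\gamma\in\Gamma$, $\mathit{state}\in\Gamma\cup\{\mathit{abort}\}$) is the relation inductively defined by: - $x:=e:\gamma\rightsquigarrow\mathit{abort}$ if $[\![e]\!]\gamma={!}$; otherwise $x:=e:\gamma\rightsquigarrow\gamma[x\mapsto[\![e]\!]\gamma]$. - $x:=\&y:\gamma\rightsquigarrow\gamma[x\mapsto y']$; $\mathit{skip}:\gamma\rightsquigarrow\gamma$.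 - $*x:=e:\gamma\rightsquigarrow\mathit{state}$ if $\gamma(x)=z'$ and $z:=e:\gamma\rightsquigarrow\mathit{state}$; $*x:=e:\gamma\rightsquigarrow\mathit{abort}$ if $\gamma(x)\notin\mathit{Addrs}$. - $x:=*y:\gamma\rightsquigarrow\gamma'$ if $\gamma(y)=z'$ and $x:=z:\gamma\rightsquigarrow\gamma'$; $x:=*y:\gamma\rightsquigarrow\mathit{abort}$ if $\gamma(y)\notin\mathit{Addrs}$. - $S_1;S_2:\gamma\rightsquigarrow\mathit{abort}$ if $S_1:\gamma\rightsquigarrow\mathit{abort}$; $S_1;S_2:\gamma\rightsquigarrow\mathit{state}$ if $S_1:\gamma\rightsquigarrow\gamma''\in\Gamma$ and $S_2:\gamma''\rightsquigarrow\mathit{state}$. - $\mathit{if}\ b\ \mathit{then}\ S_t\ \mathit{else}\ S_f:\gamma\rightsquigarrow\mathit{abort}$ if $[\![b]\!]\gamma={!}$; it $\rightsquigarrow\mathit{state}$ if $[\![b]\!]\gamma=\mathit{true}$ and $S_t:\gamma\rightsquigarrow\mathit{state}$, or $[\![b]\!]\gamma=\mathit{false}$ and $S_f:\gamma\rightsquigarrow\mathit{state}$. - $\mathit{while}\ b\ \mathit{do}\ S_t:\gamma\rightsquigarrow\mathit{abort}$ if $[\![b]\!]\gamma={!}$; it $\rightsquigarrow\gamma$ if $[\![b]\!]\gamma=\mathit{false}$; if $[\![b]\!]\gamma=\mathit{true}$, it $\rightsquigarrow\mathit{abort}$ when $S_t:\gamma\rightsquigarrow\mathit{abort}$, and it $\rightsquigarrow\mathit{state}$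 when $S_t:\gamma\rightsquigarrow\gamma''\in\Gamma$ and $\mathit{while}\ b\ \mathit{do}\ S_t:\gamma''\rightsquigarrow\mathit{state}$. - $\mathit{par}\{\{S_1\},\ldots,\{S_n\}\}:\gamma\rightsquigarrow\gamma'$ if there are a permutation $\theta$ of $\{1,\ldots,n\}$ and states $\gamma=\gamma_1,\ldots,\gamma_{n+1}=\gamma'$ in $\Gamma$ with $S_{\theta(i)}:\gamma_i\rightsquigarrow\gamma_{i+1}$ for all $1\le i\le n$. It $\rightsquigarrow\mathit{abort}$ if there are $1\le m\le n$, an injective $\beta:\{1,\ldots,m\}\to\{1,\ldots,n\}$ and states $\gamma=\gamma_1,\ldots,\gamma_{m+1}=\mathit{abort}$ with $S_{\beta(i)}:\gamma_i\rightsquigarrow\gamma_{i+1}$ for all $1\le i\le m$. - $\mathit{par\text{-}if}\{(b_1,S_1),\ldots,(b_n,S_n)\}:\gamma\rightsquigarrow\mathit{state}$ if $\mathit{par}\{\{\mathit{if}\ b_1\ \mathit{then}\ S_1\ \mathit{else}\ \mathit{skip}\},\ldots,\{\mathit{if}\ b_n\ \mathit{then}\ S_n\ \mathit{else}\ \mathit{skip}\}\}:\gamma\rightsquigarrow\mathit{state}$. - $\mathit{par\text{-}for}\{S\}:\gamma\rightsquigarrow\mathit{state}$ if for some $n\ge1$, $\mathit{par}\{\{S\},\ldots,\{S\}\}:\gamma\rightsquigarrow\mathit{state}$ with $n$ copies of $S$. **Points-to types.** $\mathit{PTS}$ is the set of maps $\mathit{pts}:\mathit{Var}\to 2^{\mathit{Addrs}}$;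 $\mathit{pts}\le\mathit{pts}'$ iff $\mathit{pts}(x)\subseteq\mathit{pts}'(x)$ for all $x$; $\cup$ on $\mathit{PTS}$ is pointwise union. **Pointer-analysis type system.** Expression judgements $e:\mathit{pts}\to A$ ($A\subseteq\mathit{Addrs}$): $n:\mathit{pts}\to\emptyset$; $x:\mathit{pts}\to\mathit{pts}(x)$; $e_1\oplus e_2:\mathit{pts}\to\emptyset$. The only statement judgements $S:\mathit{pts}\to\mathit{pts}'$ of this system needed below are those for assignments, derived by: $x:=e:\mathit{pts}\to\mathit{pts}[x\mapsto A]$ if $e:\mathit{pts}\to A$; $x:=*y:\mathit{pts}\to\mathit{pts}'$ if $x:=z:\mathit{pts}\to\mathit{pts}'$ for all $z'\in\mathit{pts}(y)$; $*x:=e:\mathit{pts}\to\mathit{pts}'$ if $z:=e:\mathit{pts}\to\mathit{pts}'$ for all $z'\in\mathit{pts}(x)$; and the consequence rule: $S:\mathit{pts}_1'\to\mathit{pts}_2'$ if $\mathit{pts}_1'\le\mathit{pts}_1$, $S:\mathit{pts}_1\to\mathit{pts}_2$ and $\mathit{pts}_2\le\mathit{pts}_2'$. **Live-variables type system.** Live types are pairs $(\mathit{pts},l)\in\mathit{PTS}\times\mathcal{P}(\mathit{Var})$, with $(\mathit{pts},l)\le(\mathit{pts}',l')$ iff $\mathit{pts}\le\mathit{pts}'$ and $l\supseteq l'$. Judgements $S:(\mathit{pts},l)\to(\mathit{pts}',l')$ are inductively derived by the following rules (premises without live components are pointer-analysis judgements): - if $x:=e:\mathit{pts}\to\mathit{pts}'$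 and $x\notin l'$: $x:=e:(\mathit{pts},l')\to(\mathit{pts}',l')$. - if $x:=e:\mathit{pts}\to\mathit{pts}'$ and $x\in l'$: $x:=e:(\mathit{pts},(l'\setminus\{x\})\cup FV(e))\to(\mathit{pts}',l')$. - $x:=\&y:(\mathit{pts},l'\setminus\{x\})\to(\mathit{pts}[x\mapsto\{y'\}],l')$; $\mathit{skip}:(\mathit{pts},l)\to(\mathit{pts},l)$. - if $x:=*y:\mathit{pts}\to\mathit{pts}'$ and $x\notin l'$: $x:=*y:(\mathit{pts},l'\cup\{y\})\to(\mathit{pts}',l')$. - if $x:=*y:\mathit{pts}\to\mathit{pts}'$ and $x\in l'$: $x:=*y:(\mathit{pts},(l'\setminus\{x\})\cup\{y\}\cup\{z\mid z'\in\mathit{pts}(y)\})\to(\mathit{pts}',l')$. - if $*x:=e:\mathit{pts}\to\mathit{pts}'$ and $\{z\mid z'\in\mathit{pts}(x)\}\cap l'=\emptyset$: $*x:=e:(\mathit{pts},l'\cup\{x\})\to(\mathit{pts}',l')$. - if $*x:=e:\mathit{pts}\to\mathit{pts}'$ and $\{z\mid z'\in\mathit{pts}(x)\}\cap l'\neq\emptyset$: $*x:=e:(\mathit{pts},l'\cup FV(e)\cup\{x\})\to(\mathit{pts}',l')$. - if for every $i$, $S_i:(\mathit{pts}\cup\bigcup_{j\ne i}\mathit{pts}_j,\,l_i)\to(\mathit{pts}_i,\,l'\cup\bigcup_{j\neq i}l_j)$: $\mathit{par}\{\{S_1\},\ldots,\{S_n\}\}:(\mathit{pts},\bigcup_i l_i)\to(\bigcup_i\mathit{pts}_i,l')$.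 - if $\mathit{par}\{\{\mathit{if}\ b_1\ \mathit{then}\ S_1\ \mathit{else}\ \mathit{skip}\},\ldots,\{\mathit{if}\ b_n\ \mathit{then}\ S_n\ \mathit{else}\ \mathit{skip}\}\}:(\mathit{pts},l)\to(\mathit{pts}',l')$: $\mathit{par\text{-}if}\{(b_1,S_1),\ldots,(b_n,S_n)\}:(\mathit{pts},l)\to(\mathit{pts}',l')$. - if $S:(\mathit{pts}\cup\mathit{pts}',l)\to(\mathit{pts}',l'\cup l)$: $\mathit{par\text{-}for}\{S\}:(\mathit{pts},l)\to(\mathit{pts}',l')$. - if $S_1:(\mathit{pts},l)\to(\mathit{pts}'',l'')$ and $S_2:(\mathit{pts}'',l'')\to(\mathit{pts}',l')$: $S_1;S_2:(\mathit{pts},l)\to(\mathit{pts}',l')$. - if $S_t:(\mathit{pts},l)\to(\mathit{pts}',l')$ and $S_f:(\mathit{pts},l)\to(\mathit{pts}',l')$: $\mathit{if}\ b\ \mathit{then}\ S_t\ \mathit{else}\ S_f:(\mathit{pts},l\cup FV(b))\to(\mathit{pts}',l')$. - if $l=l'\cup FV(b)$ and $S_t:(\mathit{pts},l')\to(\mathit{pts},l)$: $\mathit{while}\ b\ \mathit{do}\ S_t:(\mathit{pts},l)\to(\mathit{pts},l')$. - (consequence) if $(\mathit{pts}_1',l_1')\le(\mathit{pts}_1,l_1)$, $S:(\mathit{pts}_1,l_1)\to(\mathit{pts}_2,l_2)$ and $(\mathit{pts}_2,l_2)\le(\mathit{pts}_2',l_2')$: $S:(\mathit{pts}_1',l_1')\to(\mathit{pts}_2',l_2')$.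 **Relations on states.** For $\gamma,\gamma'\in\Gamma$: $\gamma\models_l\mathit{pts}$ iff for all $x\in l$, $\gamma(x)\in\mathit{Addrs}$ implies $\gamma(x)\in\mathit{pts}(x)$; $\gamma\sim_l\gamma'$ iff $\gamma(x)=\gamma'(x)$ for all $x\in l$; $\gamma\sim_{(\mathit{pts},l)}\gamma'$ iff $\gamma\models_l\mathit{pts}$, $\gamma'\models_l\mathit{pts}$ and $\gamma\sim_l\gamma'$. *)

(* Defs.v *)
From HB Require Import structures.
From mathcomp Require Import all_boot all_order all_fingroup all_algebra.
From mathcomp Require Import boolp classical_sets.

Set Implicit Arguments.
Unset Strict Implicit.
Unset Printing Implicit Defensive.

Local Open Scope classical_set_scope.

(* [Addr x] is the formal address x' of the variable x. *)
Record addr (V : Type) := Addr { addr_var : V }.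
HB.instance Definition _ (V : Type) := [isNew for @addr_var V].
HB.instance Definition _ (V : eqType) := [Equality of addr V by <:].

Definition value (V : Type) : Type := (int + addr V)%type.

Definition env (V : Type) := V -> value V.

Inductive state (V : Type) := Ok of env V | Abort.
Arguments Abort {V}.

Definition upd (V : eqType) (T : Type) (f : V -> T) (x : V) (t : T) : V -> T :=
  fun y => if y == x then t else f y.

Inductive binop := Add | Sub | Mul.

Inductive aexp (V : Type) :=
  | AVar of V
  | ANum of int
  | ABin of binop & aexp V & aexp V.
Arguments ANum {V} n.

Inductive bexp (V : Type) :=
  | BTrue
  | BFalse
  | BNot of bexp V
  | BEq of aexp V & aexp V
  | BLe of aexp V & aexp V
  | BAnd of bexp V & bexp V
  | BOr of bexp V & bexp V.

(* A nonempty family S_1, ..., S_n of parallel components is indexed by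
   ordinals of the form 'I_n.+1. *)
Inductive stmt (V : Type) :=
  | Assign of V & aexp V                           (* x := e  *)
  | AddrOf of V & V                                (* x := &y *)
  | Store of V & aexp V                            (* *x := e *)
  | Fetch of V & V                                 (* x := *y *)
  | Skip
  | Seq of stmt V & stmt V
  | If of bexp V & stmt V & stmt V
  | While of bexp V & stmt V
  | Par n of 'I_n.+1 -> stmt V
  | ParIf n of 'I_n.+1 -> bexp V & 'I_n.+1 -> stmt V
  | ParFor of stmt V.
Arguments Skip {V}.

Fixpoint aexp_fv (V : Type) (e : aexp V) : set V :=
  match e with
  | AVar x => [set x]
  | ANum _ => set0
  | ABin _ e1 e2 => aexp_fv e1 `|` aexp_fv e2
  end.

Fixpoint bexp_fv (V : Type) (b : bexp V) : set V :=
  match b with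
  | BTrue | BFalse => set0
  | BNot b1 => bexp_fv b1
  | BEq e1 e2 | BLe e1 e2 => aexp_fv e1 `|` aexp_fv e2
  | BAnd b1 b2 | BOr b1 b2 => bexp_fv b1 `|` bexp_fv b2
  end.

Definition binop_eval (o : binop) (m n : int) : int :=
  match o with
  | Add => (m + n)%R
  | Sub => (m - n)%R
  | Mul => (m * n)%R
  end.

(* [None] is the error value. *)
Fixpoint aeval (V : Type) (g : env V) (e : aexp V) : option (value V) :=
  match e with
  | AVar x => Some (g x)
  | ANum n => Some (inl n)
  | ABin o e1 e2 =>
      match aeval g e1, aeval g e2 with
      | Some (inl m), Some (inl n) => Some (inl (binop_eval o m n))
      | _, _ => None
      end
  end.

(* Conjunction and disjunction are strict: an error in either operand
   propagates. *)
Fixpoint beval (V : eqType) (g : env V) (b : bexp V) : option bool :=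
  match b with
  | BTrue => Some true
  | BFalse => Some false
  | BNot b1 => omap negb (beval g b1)
  | BEq e1 e2 =>
      match aeval g e1, aeval g e2 with
      | Some v1, Some v2 => Some (v1 == v2)
      | _, _ => None
      end
  | BLe e1 e2 =>
      match aeval g e1, aeval g e2 with
      | Some (inl m), Some (inl n) => Some (m <= n)%R
      | _, _ => None
      end
  | BAnd b1 b2 =>
      match beval g b1, beval g b2 with
      | Some c1, Some c2 => Some (c1 && c2)
      | _, _ => None
      end
  | BOr b1 b2 =>
      match beval g b1, beval g b2 with
      | Some c1, Some c2 => Some (c1 || c2)
      | _, _ => None
      end
  end.

(* In the two rules for [Par] the intermediate states are given by a sequence
   [g], of which only finitely many terms matter; indices start at 0, so the
   last state of a complete run of n.+1 components is [g n.+1]. In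
   [exec_par_abort] the first m states g 0, ..., g m.-1 are environments and
   the final one is [Abort]. *)
Inductive exec (V : eqType) : stmt V -> env V -> state V -> Prop :=
  | exec_assign_abort x e g :
      aeval g e = None -> exec (Assign x e) g Abort
  | exec_assign x e g v :
      aeval g e = Some v -> exec (Assign x e) g (Ok (upd g x v))
  | exec_addrof x y g :
      exec (AddrOf x y) g (Ok (upd g x (inr (Addr y))))
  | exec_skip g :
      exec Skip g (Ok g)
  | exec_store x e (g : env V) z s :
      g x = inr (Addr z) -> exec (Assign z e) g s -> exec (Store x e) g s
  | exec_store_abort x e (g : env V) :
      (forall a, g x <> inr a) -> exec (Store x e) g Abort
  | exec_fetch x y (g : env V) z g' :
      g y = inr (Addr z) -> exec (Assign x (AVar z)) g (Ok g') ->
      exec (Fetch x y) g (Ok g')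
  | exec_fetch_abort x y (g : env V) :
      (forall a, g y <> inr a) -> exec (Fetch x y) g Abort
  | exec_seq_abort S1 S2 g :
      exec S1 g Abort -> exec (Seq S1 S2) g Abort
  | exec_seq S1 S2 g g'' s :
      exec S1 g (Ok g'') -> exec S2 g'' s -> exec (Seq S1 S2) g s
  | exec_if_abort b St Sf g :
      beval g b = None -> exec (If b St Sf) g Abort
  | exec_if_true b St Sf g s :
      beval g b = Some true -> exec St g s -> exec (If b St Sf) g s
  | exec_if_false b St Sf g s :
      beval g b = Some false -> exec Sf g s -> exec (If b St Sf) g s
  | exec_while_abort b St g :
      beval g b = None -> exec (While b St) g Abort
  | exec_while_false b St g :
      beval g b = Some false -> exec (While b St) g (Ok g)
  | exec_while_true_abort b St g :
      beval g b = Some true -> exec St g Abort -> exec (While b St) g Abort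
  | exec_while_true b St g g'' s :
      beval g b = Some true -> exec St g (Ok g'') ->
      exec (While b St) g'' s -> exec (While b St) g s
  | exec_par n (Ss : 'I_n.+1 -> stmt V) (theta : 'S_n.+1) (g : nat -> env V) :
      (forall i : 'I_n.+1, exec (Ss (theta i)) (g i) (Ok (g i.+1))) ->
      exec (Par Ss) (g 0) (Ok (g n.+1))
  | exec_par_abort n (Ss : 'I_n.+1 -> stmt V) m (beta : 'I_m -> 'I_n.+1)
        (g : nat -> env V) :
      0 < m <= n.+1 -> injective beta ->
      (forall i : 'I_m,
         exec (Ss (beta i)) (g i) (if i.+1 < m then Ok (g i.+1) else Abort)) ->
      exec (Par Ss) (g 0) Abort
  | exec_parif n (bs : 'I_n.+1 -> bexp V) (Ss : 'I_n.+1 -> stmt V) g s :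
      exec (Par (fun i => If (bs i) (Ss i) Skip)) g s ->
      exec (ParIf bs Ss) g s
  | exec_parfor n S g s :
      exec (Par (fun _ : 'I_n.+1 => S)) g s -> exec (ParFor S) g s.

Definition pts (V : Type) := V -> set (addr V).

Definition pts_le (V : Type) (p q : pts V) := forall x, p x `<=` q x.

Definition ptsU (V : Type) (p q : pts V) : pts V := fun x => p x `|` q x.

Definition pts_bigU (V I : Type) (D : set I) (P : I -> pts V) : pts V :=
  fun x => \bigcup_(i in D) P i x.

(* The variables whose addresses belong to A. *)
Definition vars_of (V : Type) (A : set (addr V)) : set V := [set z | A (Addr z)].

Inductive aexp_typed (V : Type) (p : pts V) : aexp V -> set (addr V) -> Prop :=
  | aexp_typed_num n : aexp_typed p (ANum n) set0
  | aexp_typed_var x : aexp_typed p (AVar x) (p x)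
  | aexp_typed_bin o e1 e2 : aexp_typed p (ABin o e1 e2) set0.

(* The fragment of the pointer analysis used by the live-variables system:
   assignments, fetches and stores. *)
Inductive pts_typed (V : eqType) : stmt V -> pts V -> pts V -> Prop :=
  | pts_typed_assign x e p A :
      aexp_typed p e A -> pts_typed (Assign x e) p (upd p x A)
  | pts_typed_fetch x y (p p' : pts V) :
      (forall z, p y (Addr z) -> pts_typed (Assign x (AVar z)) p p') ->
      pts_typed (Fetch x y) p p'
  | pts_typed_store x e (p p' : pts V) :
      (forall z, p x (Addr z) -> pts_typed (Assign z e) p p') ->
      pts_typed (Store x e) p p'
  | pts_typed_csq S p1 p2 p1' p2' :
      pts_le p1' p1 -> pts_typed S p1 p2 -> pts_le p2 p2' ->
      pts_typed S p1' p2'.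

Definition ltype (V : Type) : Type := (pts V * set V)%type.

(* Contravariant in the set of live variables. *)
Definition ltype_le (V : Type) (t t' : ltype V) :=
  pts_le t.1 t'.1 /\ t'.2 `<=` t.2.

Inductive live_typed (V : eqType) : stmt V -> ltype V -> ltype V -> Prop :=
  | live_assign_dead x e p p' (l' : set V) :
      pts_typed (Assign x e) p p' -> ~ l' x ->
      live_typed (Assign x e) (p, l') (p', l')
  | live_assign x e p p' (l' : set V) :
      pts_typed (Assign x e) p p' -> l' x ->
      live_typed (Assign x e) (p, (l' `\ x) `|` aexp_fv e) (p', l')
  | live_addrof x y p l' :
      live_typed (AddrOf x y) (p, l' `\ x) (upd p x [set Addr y], l')
  | live_skip p l :
      live_typed Skip (p, l) (p, l)
  | live_fetch_dead x y p p' (l' : set V) :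
      pts_typed (Fetch x y) p p' -> ~ l' x ->
      live_typed (Fetch x y) (p, l' `|` [set y]) (p', l')
  | live_fetch x y p p' (l' : set V) :
      pts_typed (Fetch x y) p p' -> l' x ->
      live_typed (Fetch x y) (p, (l' `\ x) `|` [set y] `|` vars_of (p y)) (p', l')
  | live_store_dead x e p p' (l' : set V) :
      pts_typed (Store x e) p p' -> vars_of (p x) `&` l' = set0 ->
      live_typed (Store x e) (p, l' `|` [set x]) (p', l')
  | live_store x e p p' (l' : set V) :
      pts_typed (Store x e) p p' -> vars_of (p x) `&` l' <> set0 ->
      live_typed (Store x e) (p, l' `|` aexp_fv e `|` [set x]) (p', l')
  | live_par n (Ss : 'I_n.+1 -> stmt V) p (P : 'I_n.+1 -> pts V)
        (L : 'I_n.+1 -> set V) l' :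
      (forall i, live_typed (Ss i)
                   (ptsU p (pts_bigU [set~ i] P), L i)
                   (P i, l' `|` \bigcup_(j in [set~ i]) L j)) ->
      live_typed (Par Ss) (p, \bigcup_i L i) (pts_bigU setT P, l')
  | live_parif n (bs : 'I_n.+1 -> bexp V) (Ss : 'I_n.+1 -> stmt V) t t' :
      live_typed (Par (fun i => If (bs i) (Ss i) Skip)) t t' ->
      live_typed (ParIf bs Ss) t t'
  | live_parfor S p p' l l' :
      live_typed S (ptsU p p', l) (p', l' `|` l) ->
      live_typed (ParFor S) (p, l) (p', l')
  | live_seq S1 S2 t t'' t' :
      live_typed S1 t t'' -> live_typed S2 t'' t' ->
      live_typed (Seq S1 S2) t t'
  | live_if b St Sf p l t' :
      live_typed St (p, l) t' -> live_typed Sf (p, l) t' ->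
      live_typed (If b St Sf) (p, l `|` bexp_fv b) t'
  | live_while b St p l l' :
      l = l' `|` bexp_fv b -> live_typed St (p, l') (p, l) ->
      live_typed (While b St) (p, l) (p, l')
  | live_csq S t1 t2 t1' t2' :
      ltype_le t1' t1 -> live_typed S t1 t2 -> ltype_le t2 t2' ->
      live_typed S t1' t2'.

Definition sat (V : Type) (l : set V) (p : pts V) (g : env V) :=
  forall x, l x -> forall a, g x = inr a -> p x a.

Definition agree (V : Type) (l : set V) (g h : env V) :=
  forall x, l x -> g x = h x.

Definition sim (V : Type) (t : ltype V) (g h : env V) :=
  [/\ sat t.2 t.1 g, sat t.2 t.1 h & agree t.2 g h].

(* Main.v *)
Require Import Defs.
From HB Require Import structures.
From mathcomp Require Import all_boot all_order all_fingroup all_algebra.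
From mathcomp Require Import boolp classical_sets.

(** Induction on the typing derivation. For a parallel statement, the run from
    the second state uses the same interleaving order as the given run: when
    S_i has just been executed, the states agree on l' and on every l_j with
    j <> i, hence on what any component still to be executed needs. The second
    run never gets stuck, because an aborting component would make the whole
    parallel statement abort. *)

Set Implicit Arguments.
Unset Strict Implicit.
Unset Printing Implicit Defensive.

Local Open Scope classical_set_scope.

(** * Soundness of a pair of live types, and consequence *)

(** Isolating this semantic property of a pair of types turns each typing rule into a closure
    property, proved without reference to derivations. *)
Definition sound (V : eqType) (S : stmt V) (t t' : ltype V) :=
  forall g g' gs : env V,
    exec S g (Ok g') -> sim t g gs -> ~ exec S gs Abort ->
    exists gs' : env V, exec S gs (Ok gs') /\ sim t' g' gs'.

Lemma pts_le_refl (V : Type) (p : pts V) : pts_le p p.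
Proof. by move=> x. Qed.

#[local] Hint Resolve pts_le_refl : core.

Lemma sim_le (V : Type) (t t' : ltype V) (g h : env V) :
  ltype_le t t' -> sim t g h -> sim t' g h.
Proof.
move=> [lep lel] [sg sh gh]; split.
- by move=> x /lel lx a /(sg x lx) /lep.
- by move=> x /lel lx a /(sh x lx) /lep.
- by move=> x /lel /gh.
Qed.

Lemma sound_csq (V : eqType) (S : stmt V) t1 t2 t1' t2' :
  ltype_le t1' t1 -> sound S t1 t2 -> ltype_le t2 t2' -> sound S t1' t2'.
Proof.
move=> le1 sS le2 g g' gs gg' /(sim_le le1) sim1 nab.
have [gs' [ex sim2]] := sS _ _ _ gg' sim1 nab.
by exists gs'; split=> //; apply: sim_le sim2.
Qed.

(** * Evaluation depends only on free variables *)

Lemma aeval_agree (V : Type) (l : set V) (g h : env V) (e : aexp V) :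
  agree l g h -> aexp_fv e `<=` l -> aeval g e = aeval h e.
Proof.
move=> gh; elim: e => [x|n|o e1 IH1 e2 IH2] //= sub.
- by rewrite gh //; apply: sub.
- have -> : aeval g e1 = aeval h e1 by apply: IH1 => x ex; apply: sub; left.
  by have -> : aeval g e2 = aeval h e2 by apply: IH2 => x ex; apply: sub; right.
Qed.

Lemma beval_agree (V : eqType) (l : set V) (g h : env V) (b : bexp V) :
  agree l g h -> bexp_fv b `<=` l -> beval g b = beval h b.
Proof.
move=> gh; elim: b => [||b IH|e1 e2|e1 e2|b1 IH1 b2 IH2|b1 IH1 b2 IH2] //= sub;
  rewrite ?IH //.
1,2: have /(aeval_agree gh)-> : aexp_fv e1 `<=` l by
  move=> x ex; apply: sub; left.
1,2: by have /(aeval_agree gh)-> : aexp_fv e2 `<=` l by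
  move=> x ex; apply: sub; right.
all: have -> : beval g b1 = beval h b1 by apply: IH1 => x ex; apply: sub; left.
all: have -> // : beval g b2 = beval h b2.
all: by apply: IH2 => x ex; apply: sub; right.
Qed.

(** * Inversion of the pointer analysis *)

(** Consequence may shrink the source and enlarge the target, so only inclusions survive. The second
    one concerns variables alone, since no other expression evaluates to an address. *)
Lemma pts_typed_assign_inv (V : eqType) (x : V) (e : aexp V) (p p' : pts V) :
  pts_typed (Assign x e) p p' ->
  (forall y, y != x -> p y `<=` p' y) /\
  (forall y, e = AVar y -> p y `<=` p' x).
Proof.
move E: (Assign x e) => S tS; elim: tS x e E => //.
- move=> x e q A tA _ _ [-> ->]; split.
    by move=> y /negbTE yx; rewrite /upd yx.
  by move=> y ey; move: tA; rewrite /upd eqxx ey => tA; inversion tA.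
- move=> S0 p1 p2 p1' p2' le1 _ IH le2 x e /IH [H1 H2]; split.
    by move=> y yx a /le1 /(H1 y yx) /le2.
  by move=> y ey a /le1 /(H2 y ey) /le2.
Qed.

Lemma pts_typed_fetch_inv (V : eqType) (x y z : V) (p p' : pts V) :
  pts_typed (Fetch x y) p p' -> p y (Addr z) ->
  pts_typed (Assign x (AVar z)) p p'.
Proof.
move E: (Fetch x y) => S tS; elim: tS E => //.
- by move=> ? ? ? ? H _ [-> ->] /H.
- move=> ? ? ? ? ? le1 _ IH le2 /IH {}IH /le1 /IH H.
  exact: pts_typed_csq le1 H le2.
Qed.

Lemma pts_typed_store_inv (V : eqType) (x z : V) (e : aexp V) (p p' : pts V) :
  pts_typed (Store x e) p p' -> p x (Addr z) -> pts_typed (Assign z e) p p'.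
Proof.
move E: (Store x e) => S tS; elim: tS E => //.
- by move=> ? ? ? ? H _ [-> ->] /H.
- move=> ? ? ? ? ? le1 _ IH le2 /IH {}IH /le1 /IH H.
  exact: pts_typed_csq le1 H le2.
Qed.

(** * Assignments, fetches and stores *)

(** Asking only for inclusions into [l] covers both assignment rules (the last hypothesis is vacuous
    when [x] is dead) and the assignments to which fetches and stores reduce. *)
Lemma sound_assign (V : eqType) (x : V) (e : aexp V) (p p' : pts V)
    (l l' : set V) :
  pts_typed (Assign x e) p p' -> l' `\ x `<=` l ->
  (l' x -> aexp_fv e `<=` l) -> sound (Assign x e) (p, l) (p', l').
Proof.
move=> /pts_typed_assign_inv [H1 H2] subl sube g g' gs ex [/= sg sh gh] nab.
inversion_clear ex.
(* If [x] is dead, the states may disagree on [e]; that [e] has a value at [gs] comes from the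
   absence of abort. *)
case E: (aeval gs e) => [w|]; last by case: nab; apply: exec_assign_abort.
exists (upd gs x w); split; first exact: exec_assign.
have vw : l' x -> v = w.
  by move=> /sube /(aeval_agree gh); rewrite H E => -[].
have lP y : l' y -> y != x -> l y.
  by move=> ly /eqP yx; apply: subl; split.
have satP (k : env V) u : sat l p k -> aeval k e = Some u ->
    sat l' p' (upd k x u).
  move=> sk ku y ly a; rewrite /upd; case: eqVneq => [yx|yx ka]; last first.
    by apply: H1 => //; apply: sk ka; apply: lP.
  rewrite yx in ly * => ua; subst u.
  (* Only a variable [z] can yield an address; [z] is then live before, so the address lies in
     [p z], hence in [p' x]. *)
  case: e ku H2 sube {H E nab} => [z|n|o e1 e2] /=.
  - by move=> [kz] H2 sube; apply: (H2 z) => //; apply: sk kz; apply: sube.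
  - by [].
  - by case: (aeval k e1) => // -[] // m; case: (aeval k e2) => // -[].
split; [exact: satP|exact: satP|move=> y ly /=].
rewrite /upd; case: eqVneq => [yx|yx]; last exact/gh/lP.
by apply: vw; rewrite -yx.
Qed.

Lemma sound_addrof (V : eqType) (x y : V) (p : pts V) (l' : set V) :
  sound (AddrOf x y) (p, l' `\ x) (upd p x [set Addr y], l').
Proof.
move=> g g' gs ex [/= sg sh gh] _; inversion_clear ex.
exists (upd gs x (inr (Addr y))); split; first exact: exec_addrof.
have satP (k : env V) : sat (l' `\ x) p k ->
    sat l' (upd p x [set Addr y]) (upd k x (inr (Addr y))).
  move=> sk z lz a; rewrite /upd; case: eqVneq => [_ [<-] //|/eqP zx].
  by apply: sk.
split; [exact: satP|exact: satP|move=> z lz /=].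
by rewrite /upd; case: eqVneq => // /eqP zx; apply: gh.
Qed.

(** As [y] is live, both states hold the same address z' in [y], and z' lies in [p y]; both runs are
    thus the well-typed assignment x := z. *)
Lemma sound_fetch (V : eqType) (x y : V) (p p' : pts V) (l l' : set V) :
  pts_typed (Fetch x y) p p' -> l y -> l' `\ x `<=` l ->
  (l' x -> vars_of (p y) `<=` l) -> sound (Fetch x y) (p, l) (p', l').
Proof.
move=> tS ly subl subp g g' gs ex simg nab; have [/= sg sh gh] := simg.
inversion ex as [| | | | | |? ? ? z ? gy ex1| | | | | | | | | | | | | |]; subst.
have pyz : p y (Addr z) by apply: sg gy.
have gsy : gs y = inr (Addr z) by rewrite -gh.
have sP : sound (Assign x (AVar z)) (p, l) (p', l').
  apply: sound_assign => //; first exact: pts_typed_fetch_inv tS pyz.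
  by move=> /subp sub w /= ->; apply: sub.
have nab1 : ~ exec (Assign x (AVar z)) gs Abort by move=> ab; inversion ab.
have [gs' [ex' sim']] := sP _ _ _ ex1 simg nab1.
by exists gs'; split=> //; apply: exec_fetch ex'.
Qed.

(** As for fetches, both states write to the same [z]. If [z] is live afterwards, it witnesses that
    the intersection is nonempty, so the variables of [e] are live before. *)
Lemma sound_store (V : eqType) (x : V) (e : aexp V) (p p' : pts V)
    (l l' : set V) :
  pts_typed (Store x e) p p' -> l x -> l' `<=` l ->
  (vars_of (p x) `&` l' <> set0 -> aexp_fv e `<=` l) ->
  sound (Store x e) (p, l) (p', l').
Proof.
move=> tS lx subl sube g g' gs ex simg nab; have [/= sg sh gh] := simg.
inversion ex as [| | | |? ? ? z ? gx ex1| | | | | | | | | | | | | | | |]; subst.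
have pxz : p x (Addr z) by apply: sg gx.
have gsx : gs x = inr (Addr z) by rewrite -gh.
have sP : sound (Assign z e) (p, l) (p', l').
  apply: sound_assign; first exact: pts_typed_store_inv tS pxz.
  - by move=> w [/subl].
  - by move=> lz; apply: sube; apply/eqP/set0P; exists z.
have nab1 : ~ exec (Assign z e) gs Abort.
  by move=> ab; apply: nab; apply: exec_store ab.
have [gs' [ex' sim']] := sP _ _ _ ex1 simg nab1.
by exists gs'; split=> //; apply: exec_store ex'.
Qed.

(** * Sequential control structures *)

Lemma sound_seq (V : eqType) (S1 S2 : stmt V) (t t'' t' : ltype V) :
  sound S1 t t'' -> sound S2 t'' t' -> sound (Seq S1 S2) t t'.
Proof.
move=> s1 s2 g g' gs ex simg nab.
inversion ex as [| | | | | | | | |? ? ? g'' ? ex1 ex2| | | | | | | | | | |].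
subst.
have [|h [exh simh]] := s1 _ _ _ ex1 simg.
  by move=> ab; apply: nab; apply: exec_seq_abort.
have [|gs' [exs sims]] := s2 _ _ _ ex2 simh.
  by move=> ab; apply: nab; apply: exec_seq exh ab.
by exists gs'; split=> //; apply: exec_seq exh exs.
Qed.

Lemma sound_if (V : eqType) (b : bexp V) (St Sf : stmt V) (p : pts V)
    (l : set V) (t' : ltype V) :
  sound St (p, l) t' -> sound Sf (p, l) t' ->
  sound (If b St Sf) (p, l `|` bexp_fv b) t'.
Proof.
move=> sT sF g g' gs ex simg nab.
have [_ _ /= gh] := simg.
have bE : beval g b = beval gs b.
  by apply: (beval_agree gh) => x; right.
have simg' : sim (p, l) g gs.
  by apply: sim_le simg; split=> //= x; left.
inversion ex as [| | | | | | | | | | |? ? ? ? ? gb ex1|? ? ? ? ? gb ex1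
  | | | | | | | |]; subst; rewrite bE in gb.
- have [|gs' [exs sims]] := sT _ _ _ ex1 simg'.
    by move=> ab; apply: nab; apply: exec_if_true.
  by exists gs'; split=> //; apply: exec_if_true.
- have [|gs' [exs sims]] := sF _ _ _ ex1 simg'.
    by move=> ab; apply: nab; apply: exec_if_false.
  by exists gs'; split=> //; apply: exec_if_false.
Qed.

(** The body ends in the type [(p, l)] at which the loop starts, so induction on the first run
    works, provided [gs] is generalised: each iteration begins at a new second state. *)
Lemma sound_while (V : eqType) (b : bexp V) (St : stmt V) (p : pts V)
    (l l' : set V) :
  l = l' `|` bexp_fv b -> sound St (p, l') (p, l) ->
  sound (While b St) (p, l) (p, l').
Proof.
move=> lE sS g g' gs.
move EW: (While b St) => W; move Es: (Ok g') => s ex.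
elim: ex gs EW Es => {g s W} //.
all: move=> b0 St0 g.
- move=> gb gs [? ?] [?] simg nab; subst b0 St0 g'.
  have [_ _ /= gh] := simg.
  exists gs; split; last by apply: sim_le simg; split=> //= x; rewrite lE; left.
  apply: exec_while_false; rewrite -gb.
  by apply/esym/(beval_agree gh) => x; rewrite lE; right.
- move=> g'' s gb ex1 _ _ IH gs [? ?] ? simg nab; subst b0 St0 s.
  have [_ _ /= gh] := simg.
  have gsb : beval gs b = Some true.
    by rewrite -gb; apply/esym/(beval_agree gh) => x; rewrite lE; right.
  have simg' : sim (p, l') g gs.
    by apply: sim_le simg; split=> //= x; rewrite lE; left.
  have [|h [exh simh]] := sS _ _ _ ex1 simg'.
    by move=> ab; apply: nab; apply: exec_while_true_abort.
  have [| | |gs' [exs sims]] := IH h _ _ simh => //.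
    by move=> ab; apply: nab; apply: exec_while_true exh ab.
  by exists gs'; split=> //; apply: exec_while_true exh exs.
Qed.

(** * Parallel constructs *)

(* The matches avoid the equalities between dependent pairs that [inversion]
   produces for [Par] and [ParIf]. *)
Lemma exec_par_inv (V : eqType) n (Ss : 'I_n.+1 -> stmt V) (g g' : env V) :
  exec (Par Ss) g (Ok g') ->
  exists (theta : 'S_n.+1) (h : nat -> env V),
    [/\ h 0 = g, h n.+1 = g' &
        forall i : 'I_n.+1, exec (Ss (theta i)) (h i) (Ok (h i.+1))].
Proof.
move=> ex; pose Q (S : stmt V) g s := match S, s with
  | Par n Ss, Ok g' => exists (theta : 'S_n.+1) (h : nat -> env V),
    [/\ h 0 = g, h n.+1 = g' &
        forall i : 'I_n.+1, exec (Ss (theta i)) (h i) (Ok (h i.+1))]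
  | _, _ => True end.
suff: Q (Par Ss) g (Ok g') by [].
case: ex => //=.
by move=> ? Ss' theta h exs; exists theta, h.
Qed.

Lemma exec_parif_inv (V : eqType) n (bs : 'I_n.+1 -> bexp V)
    (Ss : 'I_n.+1 -> stmt V) (g : env V) (s : state V) :
  exec (ParIf bs Ss) g s -> exec (Par (fun i => If (bs i) (Ss i) Skip)) g s.
Proof.
move=> ex; pose Q (S : stmt V) g s := match S with
  | ParIf n bs Ss => exec (Par (fun i => If (bs i) (Ss i) Skip)) g s
  | _ => True end.
suff: Q (ParIf bs Ss) g s by [].
by case: ex.
Qed.

Lemma sound_par (V : eqType) n (Ss : 'I_n.+1 -> stmt V) (p : pts V)
    (P : 'I_n.+1 -> pts V) (L : 'I_n.+1 -> set V) (l' : set V) :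
  (forall i, sound (Ss i) (ptsU p (pts_bigU [set~ i] P), L i)
                          (P i, l' `|` \bigcup_(j in [set~ i]) L j)) ->
  sound (Par Ss) (p, \bigcup_i L i) (pts_bigU setT P, l').
Proof.
move=> sS g0 g' gs /exec_par_inv [theta [g [<- <- exg]]] simg nab.
pose pre i : ltype V := (ptsU p (pts_bigU [set~ i] P), L i).
(* The invariant records only what the next component needs: the target type of each component
   covers the needs of all the others, so nothing has to be carried across several steps. The last
   clause handles the end, where no component is left. *)
have H k : k <= n.+1 -> exists h : nat -> env V,
    [/\ h 0 = gs,
        forall i : 'I_n.+1, i < k ->
          exec (Ss (theta i)) (h i) (Ok (h i.+1)),
        forall i : 'I_n.+1, i = k :> nat -> sim (pre (theta i)) (g k) (h k) &
        k = n.+1 -> sim (pts_bigU setT P, l') (g k) (h k)].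
  elim: k => [_|k IH kn].
    exists (fun=> gs); split=> // i _; apply: sim_le simg.
    by split=> [x a pa|x Lx]; [left|exists (theta i)].
  have [h [h0 exh simh _]] := IH (ltnW kn).
  pose i0 := Ordinal kn.
  have [|hk [exk simk]] := sS _ _ _ _ (exg i0) (simh i0 erefl).
    move=> ab; apply: nab; rewrite -h0.
    (* An abort of the current component completes an aborting run along the first [k.+1] entries of
       [theta]. *)
    apply: (@exec_par_abort _ _ _ k.+1 (theta \o widen_ord kn)) => //.
      by apply: inj_comp; [exact: perm_inj|move=> i j [] /val_inj].
    move=> i /=; rewrite ltnS; case: ltnP => ik; first exact: exh.
    have ik' : i = k :> nat by apply/eqP; rewrite eqn_leq ik -ltnS ltn_ord.
    by rewrite ik'; have -> : widen_ord kn i = i0 by apply: val_inj.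
  exists (fun j => if j <= k then h j else hk); split=> //.
  - move=> i; rewrite ltnS => ik; rewrite ik.
    case: ltnP => ki; first exact: exh.
    have ik' : i = k :> nat by apply/eqP; rewrite eqn_leq ik ki.
    by rewrite ik'; have -> : i = i0 by apply: val_inj.
  - move=> i ik; rewrite ltnn; apply: sim_le simk.
    (* Being distinct, the component just run and the next one occur in each other's unions over
       [[set~ _]], for [P] and for [L]. *)
    have ne : theta i0 <> theta i.
      by move=> /perm_inj ii; move: ik; rewrite -ii /= => /n_Sn.
    split=> [x a Pa|x Lx].
      by right; exists (theta i0).
    by right; exists (theta i) => // /esym.
  - move=> _; rewrite ltnn; apply: sim_le simk.
    by split=> [x a Pa|x lx]; [exists (theta i0)|left].
have [h [<- exh _ simh]] := H n.+1 (leqnn _).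
exists (h n.+1); split; last exact: simh.
by apply: (exec_par (theta := theta)) => i; apply: exh.
Qed.

(** The number of copies is fixed by the run, so [sound_par] is applied with constant families. For
    a single copy the unions over the other components are empty, whence inequalities of types and
    an appeal to consequence. *)
Lemma sound_parfor (V : eqType) (S : stmt V) (p p' : pts V) (l l' : set V) :
  sound S (ptsU p p', l) (p', l' `|` l) -> sound (ParFor S) (p, l) (p', l').
Proof.
move=> sS g g' gs ex simg nab.
inversion ex as [| | | | | | | | | | | | | | | | | | | |n ? ? ? ex1]; subst.
have sP : sound (Par (fun _ : 'I_n.+1 => S))
    (p, \bigcup_(i in [set: 'I_n.+1]) l)
    (pts_bigU [set: 'I_n.+1] (fun=> p'), l').
  apply: sound_par => i; apply: sound_csq sS _.
  - by split=> //= x a [|[_ _]]; [left|right].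
  - by split=> //= x [|[_ _]]; [left|right].
have [||gs' [exs sims]] := sP _ _ gs ex1.
- by apply: sim_le simg; split=> //= x [].
- by move=> ab; apply: nab; apply: exec_parfor ab.
exists gs'; split; first exact: exec_parfor exs.
by apply: sim_le sims; split=> //= x a [].
Qed.

(** * Induction on the typing derivation *)

Lemma live_typed_sound (V : eqType) (S : stmt V) (t t' : ltype V) :
  live_typed S t t' -> sound S t t'.
Proof.
elim=> {S t t'}.
- by move=> x e p p' l' tS lx; apply: sound_assign => // y [].
- by move=> x e p p' l' tS lx; apply: sound_assign.
- exact: sound_addrof.
- move=> p l g g' gs ex simg _; inversion ex; subst.
  by exists gs; split=> //; apply: exec_skip.
- move=> x y p p' l' tS lx; apply: (sound_fetch tS) => //; first by right.
  by move=> z [lz _]; left.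
- move=> x y p p' l' tS lx; apply: (sound_fetch tS) => //; first by left; right.
  by move=> z lz; left; left.
- by move=> x e p p' l' tS E; apply: (sound_store tS) => //; right.
- move=> x e p p' l' tS E; apply: (sound_store tS) => //; first by right.
    by move=> y ly; left; left.
  by move=> _ y ey; left; right.
- by move=> n Ss p P L l' _; apply: sound_par.
- move=> n bs Ss t t' _ IH g g' gs /exec_parif_inv ex simg nab.
  have [|gs' [exs sims]] := IH _ _ _ ex simg.
    by move=> ab; apply: nab; apply: exec_parif.
  by exists gs'; split=> //; apply: exec_parif.
- by move=> S p p' l l' _; apply: sound_parfor.
- by move=> S1 S2 t t'' t' _ s1 _ s2; apply: sound_seq s1 s2.
- by move=> b St Sf p l t' _ sT _ sF; apply: sound_if.
- by move=> b St p l l' lE _ sS; apply: sound_while.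
- by move=> S t1 t2 t1' t2' le1 _ sS le2; apply: sound_csq le1 sS le2.
Qed.

Theorem theorem3 (V : eqType) (S : stmt V) (p p' : pts V) (l l' : set V)
    (g g' gs : env V) :
  live_typed S (p, l) (p', l') ->
  exec S g (Ok g') ->
  sim (p, l) g gs ->
  ~ exec S gs Abort ->
  exists gs' : env V, exec S gs (Ok gs') /\ sim (p', l') g' gs'.
Proof. by move=> /live_typed_sound; apply. Qed.
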